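(* Fix an integer $D\geq 1$ and a constant $C>0$. Let $k$ be an even integer, written as $k=12\ell+k'$ with $k'\in\{0,4,6,8,10,14\}$ and $\ell\geq D+1$, and let $f\in S_k$ be a cusp form of weight $k$ for $\mathrm{SL}(2,\mathbb Z)$ with \[ f=q^{\ell-D}\left(1+a(1)q+\dots+a(D)q^D\right)+O\!\left(q^{\ell+1}\right),\qquad |a(j)|\leq C\ (j=1,\dots,D). \] Then, as $k\to\infty$, \[ \frac{1}{(2k)^D}F_f(2k\,t)=t^D\,\mathcal E_D\!\left(\frac1t\right)\left(1+O\!\left(\frac1k\right)\right), \] in the sense that for each $s=0,1,\dots,D$ the coefficient of $t^{D-s}$ in $(2k)^{-D}F_f(2kt)$ equals $\frac{1}{s!}\left(1+O\!\left(\frac1k\right)\right)$, with implied constants depending only on $D$ and $C$.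
   Context: $q=e^{2\pi i\tau}$ for $\tau$ in the upper half-plane. $S_k$ denotes cusp forms of weight $k$ for $\mathrm{SL}(2,\mathbb Z)$. For even $k\geq4$, $E_k=1-\frac{2k}{B_k}\sum_{n\geq1}\sigma_{k-1}(n)q^n$ is the normalized Eisenstein series, and $E_0=1$. $\Delta=q\prod_{n\geq1}(1-q^n)^{24}$ is the modular discriminant and $j=E_4^3/\Delta=q^{-1}+744+196884q+\dots$ is Klein's $j$-invariant. For a nonzero $f\in M_k$ with $k=12\ell+k'$, $k'\in\{0,4,6,8,10,14\}$, the Faber polynomial $F_f\in\mathbb C[t]$ is the unique polynomial with $f=\Delta^\ell E_{k'}\,F_f(j)$; it has degree $\ell-\operatorname{ord}_\infty(f)$ (here $D$). $\mathcal E_D(t)=\sum_{r=0}^D t^r/r!$ is the truncated exponential polynomial, so $t^D\mathcal E_D(1/t)=\sum_{s=0}^D t^{D-s}/s!$. *)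

(* Defs.v *)
From mathcomp Require Import all_boot all_order all_algebra.
From mathcomp Require Import complex.
From mathcomp Require Import all_classical all_reals all_analysis.

Set Implicit Arguments.
Unset Strict Implicit.
Unset Printing Implicit Defensive.

Import Order.TTheory GRing.Theory Num.Theory.
Import numFieldNormedType.Exports.

Local Open Scope classical_set_scope.
Local Open Scope ring_scope.
Local Open Scope complex_scope.

(* The topology of the complex numbers R[i] is carried by the regular alias
   R[i]^o; limits and complex derivatives are taken there. *)

Definition clim (R : realType) (u : nat -> R[i]) : R[i] :=
  lim ((u : nat -> R[i]^o) @ \oo).

Definition upper_half_plane (R : realType) : set R[i] :=
  [set tau | 0 < complex.Im tau].

Definition cexp (R : realType) (z : R[i]) : R[i] :=
  (expR (complex.Re z))%:C *
    (cos (complex.Im z) +i* sin (complex.Im z)).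

Definition qpar (R : realType) (tau : R[i]) : R[i] :=
  cexp (2 * pi%:C * 'i%C * tau).

(* Bernoulli numbers B_0, ..., B_n, from B_0 = 1 and
   sum_(i <= m) 'C(m+1, i) B_i = 0 for m > 0 (so B_1 = -1/2). *)
Fixpoint bernoulli_seq (n : nat) : seq rat :=
  if n is m.+1 then
    let s := bernoulli_seq m in
    rcons s (- (\sum_(i < m.+1) 'C(m.+2, i)%:R * s`_i) / m.+2%:R)
  else [:: 1].

Definition bernoulli_number (n : nat) : rat := (bernoulli_seq n)`_n.

Definition sigma (m n : nat) : nat := (\sum_(d <- divisors n) d ^ m)%N.

Definition eisenstein (R : realType) (k : nat) (tau : R[i]) : R[i] :=
  if k == 0%N then 1 else
  1 - (2 * k)%:R / ratr (bernoulli_number k) *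
      clim (fun N => \sum_(1 <= n < N) (sigma k.-1 n)%:R * qpar tau ^+ n).

Definition modular_discriminant (R : realType) (tau : R[i]) : R[i] :=
  qpar tau *
  clim (fun N => \prod_(1 <= n < N) (1 - qpar tau ^+ n) ^+ 24).

Definition klein_j (R : realType) (tau : R[i]) : R[i] :=
  eisenstein 4 tau ^+ 3 / modular_discriminant tau.

Definition holomorphic_on_H (R : realType) (f : R[i] -> R[i]) : Prop :=
  forall tau, upper_half_plane tau ->
    derivable (f : R[i]^o -> R[i]^o) tau 1.

Definition weight_invariant (R : realType) (k : nat) (f : R[i] -> R[i]) : Prop :=
  forall (a b c d : int) (tau : R[i]),
    a * d - b * c = 1 -> upper_half_plane tau ->
    f ((a%:~R * tau + b%:~R) / (c%:~R * tau + d%:~R)) =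
    (c%:~R * tau + d%:~R) ^+ k * f tau.

(* f belongs to S_k; values of f off the upper half-plane are irrelevant. *)
Definition cusp_form (R : realType) (k : nat) (f : R[i] -> R[i]) : Prop :=
  [/\ holomorphic_on_H f,
      weight_invariant k f
    & exists c : nat -> R[i], c 0%N = 0 /\
        forall tau, upper_half_plane tau ->
          ((fun N => \sum_(0 <= n < N) c n * qpar tau ^+ n) : nat -> R[i]^o)
            @ \oo --> (f tau : R[i]^o)].

(* g = O(q^n) at the cusp, i.e. as Im tau -> +oo. *)
Definition bigO_q (R : realType) (n : nat) (g : R[i] -> R[i]) : Prop :=
  exists M Y : R, forall tau, upper_half_plane tau -> Y <= complex.Im tau ->
    `|g tau| <= M%:C * `|qpar tau| ^+ n.

(* F is the Faber polynomial of f, where f has weight 12 * l + k'.  Such an F is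
   unique, since klein_j is not constant and Delta, E_k' do not vanish
   identically. *)
Definition is_faber_poly (R : realType) (l k' : nat) (f : R[i] -> R[i])
    (F : {poly R[i]}) : Prop :=
  forall tau, upper_half_plane tau ->
    f tau = modular_discriminant tau ^+ l * eisenstein k' tau * F.[klein_j tau].

(* Main.v *)
Require Import Defs.
From mathcomp Require Import all_boot all_order all_algebra.
From mathcomp Require Import complex.
From mathcomp Require Import all_classical all_reals all_analysis.
From mathcomp Require Import zify ring lra.

(* Only the q-expansions at the cusp matter.  Since q j = 1 + O(q), dividing
   f = Delta^l E_k' F(j) by Delta^l E_k' and multiplying by q^D gives
     sum_r F_(D-r) q^r (q j)^(D-r) = (1 + a(1) q + ...) (Delta/q)^(-l) / E_k'
   up to O(q^(D+1)), a unitriangular system for the coefficients of F.  The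
   coefficients of q j and 1/E_k' are fixed numbers, and since
   (Delta/q)^(-1) = 1 + 24 q + O(q^2), the coefficient of q^s in (Delta/q)^(-l)
   is binomial(l, s) 24^s + O(l^(s-1)) = (24 l)^s / s! + O(l^(s-1)).  Hence
   F_(D-s) = (24 l)^s / s! + O(l^(s-1)) by induction on s, and 24 l = 2k + O(1). *)

Set Implicit Arguments.
Unset Strict Implicit.
Unset Printing Implicit Defensive.

Import Order.TTheory GRing.Theory Num.Theory.
Import numFieldNormedType.Exports.

Local Open Scope classical_set_scope.
Local Open Scope ring_scope.
Local Open Scope complex_scope.

(** * Limits of complex sequences with geometric increments *)

Lemma normc_le_ReIm (R : realType) (z : R[i]) :
  `|z| <= (`|complex.Re z| + `|complex.Im z|)%:C.
Proof.
rewrite {1}[z]complexE (le_trans (ler_normD _ _))// rmorphD/= lerD//.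
  by rewrite normc_def /= expr0n /= addr0 sqrtr_sqr.
rewrite normrM !normc_def /= !expr0n /= expr1n add0r sqrtr1 mul1r addr0.
by rewrite sqrtr_sqr.
Qed.

Lemma Re_le_normc (R : realType) (z : R[i]) (e : R) :
  `|z| <= e%:C -> `|complex.Re z| <= e.
Proof. by rewrite -lecR; apply: le_trans; exact: normc_ge_Re. Qed.

Lemma Im_le_normc (R : realType) (z : R[i]) (e : R) :
  `|z| <= e%:C -> `|complex.Im z| <= e.
Proof.
move=> ze; rewrite -normrN -ReiNIm; apply: Re_le_normc.
by rewrite normrM [`|'i%C|]normc_def /= expr0n expr1n add0r sqrtr1 mulr1.
Qed.

Lemma real_cvg_tail (R : realType) (u e : nat -> R) :
  (forall m n, (0 < m <= n)%N -> `|u n - u m| <= e m) ->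
  (e @ \oo --> (0 : R))%classic ->
  exists x : R, (u @ \oo --> x)%classic.
Proof.
move=> ue e0.
have /cvg_ex[x ux] : (cvg (u @ \oo))%classic.
  apply: cauchy_cvg; apply: cauchy_exP => eps eps0.
  have : \forall n \near \oo, e n < eps by exact: (cvgr_lt _ e0).
  move=> [N _ HN]; exists (u N.+1), N.+1 => //= n Nn.
  rewrite /ball/= distrC (le_lt_trans (ue N.+1 n Nn))// HN//=.
by exists x.
Qed.

(** [clim] is informative only for a convergent sequence, so convergence comes first: real and
    imaginary parts are each Cauchy. The bound survives the limit because a late term is close to
    the limit and within [e m] of [z m]. *)
Lemma clim_tail (R : realType) (z : nat -> R[i]) (e : nat -> R) :
  (forall m n, (0 < m <= n)%N -> `|z n - z m| <= (e m)%:C) ->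
  (e @ \oo --> (0 : R))%classic ->
  forall m, (0 < m)%N -> `|clim z - z m| <= (e m)%:C.
Proof.
move=> ze e0.
have [x zx] : exists x : R, ((fun n => complex.Re (z n)) @ \oo --> x)%classic.
  apply: (@real_cvg_tail _ _ e) => // m n mn.
  by rewrite -raddfB; apply: Re_le_normc; exact: ze.
have [y zy] : exists y : R, ((fun n => complex.Im (z n)) @ \oo --> y)%classic.
  apply: (@real_cvg_tail _ _ e) => // m n mn.
  by rewrite -raddfB; apply: Im_le_normc; exact: ze.
have near_lim (eps : R) : 0 < eps ->
    \forall n \near \oo, `|(x +i* y) - z n| < eps%:C.
  move=> eps0; have eps20 : 0 < eps / 2 by rewrite divr_gt0.
  have zxe : \forall n \near \oo, `|x - complex.Re (z n)| < eps / 2.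
    by move/cvgrPdist_lt : zx; apply.
  have zye : \forall n \near \oo, `|y - complex.Im (z n)| < eps / 2.
    by move/cvgrPdist_lt : zy; apply.
  near=> n; rewrite (le_lt_trans (normc_le_ReIm _))// ltcR raddfB/= raddfB/=.
  by rewrite [eps]splitr ltrD//; near: n.
have zL : ((z : nat -> R[i]^o) @ \oo --> (x +i* y : R[i]^o))%classic.
  apply/cvgrPdist_lt => eps eps0.
  have epsE : (complex.Re eps)%:C = eps by apply: RRe_real; exact: gtr0_real.
  by rewrite -epsE; apply: near_lim; rewrite -ltcR epsE.
have -> : clim z = x +i* y by rewrite /clim; exact: cvg_lim zL.
move=> m m0; rewrite normc_def lecR.
apply/ler_addgt0Pr => eps eps0.
have [N _ HN] := near_lim _ eps0.
rewrite -lecR -normc_def.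
rewrite [_ - z m](_ : _ = ((x +i* y) - z (maxn N m)) + (z (maxn N m) - z m)); last first.
  by rewrite addrA subrK.
rewrite (le_trans (ler_normD _ _))// addrC rmorphD/= lerD//.
  by apply: ze; rewrite m0 leq_maxr.
by apply/ltW/HN; rewrite /= leq_maxl.
Unshelve. all: by end_near.
Qed.

Lemma clim_geometric_tail (R : realType) (z : nat -> R[i]) (A r : R) :
  0 <= A -> 0 <= r <= 1 / 2 ->
  (forall n, (0 < n)%N -> `|z n.+1 - z n| <= (A * r ^+ n)%:C) ->
  forall m, (0 < m)%N -> `|clim z - z m| <= (2 * A * r ^+ m)%:C.
Proof.
move=> A0 /andP[r0 r12] zr.
apply: (@clim_tail _ _ (fun m => 2 * A * r ^+ m)).
  move=> m n /andP[m0 mn].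
  (* Telescoping form of the geometric tail; its induction step amounts to A r^n <= 2 A (r^n -
     r^(n+1)), which is where [r <= 1 / 2] enters. *)
  have : `|z n - z m| <= (2 * A * (r ^+ m - r ^+ n))%:C.
    elim: n mn => [|n IH].
      by rewrite leqn0 => /eqP mE; rewrite mE in m0.
    rewrite leq_eqVlt => /predU1P[->|]; first by rewrite !subrr normr0 mulr0.
    rewrite ltnS => mn.
    rewrite [_ - z m](_ : _ = (z n.+1 - z n) + (z n - z m)); last first.
      by rewrite addrA subrK.
    apply: le_trans (ler_normD _ _) _.
    apply: le_trans (lerD (zr n (leq_trans m0 mn)) (IH mn)) _.
    rewrite -rmorphD lecR/=.
    have : 0 <= A * r ^+ n by rewrite mulr_ge0// exprn_ge0.
    move: (r ^+ n) (r ^+ m) (exprS r n) => rn rm -> Arn.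
    by nra.
  move=> /le_trans; apply; rewrite lecR ler_wpM2l ?mulr_ge0//.
  by rewrite lerBlDr lerDl exprn_ge0.
apply: (@cvg_geometric R (2 * A) r).
by rewrite ger0_norm// (le_lt_trans r12)//; lra.
Qed.

(** * Expansions in q at the cusp *)

Lemma norm_qpar (R : realType) (tau : R[i]) :
  `|qpar tau| = (expR (- (2 * pi * complex.Im tau)))%:C.
Proof.
rewrite /qpar; have -> : 2 * pi%:C * 'i%C * tau =
    (- (2 * pi * complex.Im tau)) +i* (2 * pi * complex.Re tau) :> R[i].
  by case: tau => x y; apply/eqP; rewrite eq_complex /=; apply/andP; split;
    apply/eqP; ring.
rewrite /cexp /=; set x := expR _; set t := _ * complex.Re _.
rewrite normrM [`|x%:C|]normc_def /= expr0n addr0 sqrtr_sqr.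
rewrite normc_def /= cos2Dsin2 sqrtr1 mulr1 ger0_norm//; exact: expR_ge0.
Qed.

Lemma qpar_neq0 (R : realType) (tau : R[i]) : qpar tau != 0.
Proof. by rewrite -normr_gt0 norm_qpar ltcR expR_gt0. Qed.

Lemma norm_qpar_le1 (R : realType) (tau : R[i]) :
  0 <= complex.Im tau -> `|qpar tau| <= 1.
Proof.
move=> t0; rewrite norm_qpar (_ : 1 = (1 : R)%:C)// lecR -expR0 ler_expR oppr_le0.
by rewrite !mulr_ge0// pi_ge0.
Qed.

Lemma norm_qpar_le (R : realType) (r : R) : 0 < r ->
  exists2 Y : R, 0 < Y &
    forall tau, Y <= complex.Im tau -> `|qpar tau| <= r%:C.
Proof.
(* Since 2 pi >= 1, |q| <= exp(- Im tau) on this range, and Im tau >= - ln r suffices. *)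
move=> r0; exists (1 + `|ln r|); first by rewrite ltr_pwDl.
move=> tau Yt; rewrite norm_qpar lecR -ler_ln ?posrE ?expR_gt0// expRK.
have pi1 : (1 : R) <= 2 * pi by have := @pi_ge2 R; lra.
have := ler_norm (- ln r); rewrite normrN; have := normr_ge0 (ln r); nra.
Qed.

(** Normalizes the constants: [0 < Y] makes membership in the upper half-plane automatic, and
    [0 <= M] lets estimates be multiplied. *)
Lemma bigO_qP (R : realType) (n : nat) (g : R[i] -> R[i]) : bigO_q n g ->
  exists M Y : R, [/\ 0 <= M, 0 < Y & forall tau, Y <= complex.Im tau ->
    `|g tau| <= M%:C * `|qpar tau| ^+ n].
Proof.
move=> [M [Y gMY]]; exists `|M|, (1 + `|Y|); split => //.
move=> tau Yt; apply: le_trans (gMY tau _ _) _.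
- by rewrite /upper_half_plane/= (lt_le_trans _ Yt)// ltr_pwDl.
- by rewrite (le_trans _ Yt)// (le_trans (ler_norm Y))// lerDr.
- by rewrite ler_wpM2r ?exprn_ge0// lecR ler_norm.
Qed.

Lemma bigO_q_le (R : realType) (m n : nat) (g : R[i] -> R[i]) :
  (m <= n)%N -> bigO_q n g -> bigO_q m g.
Proof.
move=> mn /bigO_qP[M [Y [M0 Y0 gMY]]]; exists M, Y => tau tau0 Yt.
apply: le_trans (gMY _ Yt) _; rewrite ler_wpM2l ?ler0c//.
by apply: ler_wiXn2l => //; exact/norm_qpar_le1/ltW.
Qed.

Lemma bigO_q_eq (R : realType) (n : nat) (g h : R[i] -> R[i]) :
  (exists Y : R, forall tau, upper_half_plane tau -> Y <= complex.Im tau ->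
    g tau = h tau) -> bigO_q n g -> bigO_q n h.
Proof.
move=> [Y1 gh] [M [Y2 gMY]]; exists M, (Num.max Y1 Y2) => tau tau0.
by rewrite ge_max => /andP[Y1t Y2t]; rewrite -gh//; exact: gMY.
Qed.

Lemma bigO_qD (R : realType) (n : nat) (g h : R[i] -> R[i]) :
  bigO_q n g -> bigO_q n h -> bigO_q n (fun tau => g tau + h tau).
Proof.
move=> [M1 [Y1 H1]] [M2 [Y2 H2]]; exists (M1 + M2), (Num.max Y1 Y2) => tau tau0.
rewrite ge_max => /andP[Y1t Y2t]; rewrite (le_trans (ler_normD _ _))//.
by rewrite rmorphD/= mulrDl lerD ?H1 ?H2.
Qed.

Lemma bigO_qM (R : realType) (m n : nat) (g h : R[i] -> R[i]) :
  bigO_q m g -> bigO_q n h -> bigO_q (m + n) (fun tau => g tau * h tau).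
Proof.
move=> /bigO_qP[M1 [Y1 [M10 Y10 H1]]] /bigO_qP[M2 [Y2 [M20 Y20 H2]]].
exists (M1 * M2), (Num.max Y1 Y2) => tau tau0.
rewrite ge_max => /andP[Y1t Y2t]; rewrite normrM rmorphM/= exprD mulrACA.
by rewrite ler_pM ?H1 ?H2.
Qed.

Lemma bigO_q_cst (R : realType) (c : R[i]) : bigO_q 0 (fun _ => c).
Proof.
exists (complex.Re `|c|), 0 => tau _ _.
by rewrite expr0 mulr1 (RRe_real (normr_real c)).
Qed.

Lemma bigO_q_qparX (R : realType) (n : nat) :
  bigO_q n (fun tau : R[i] => qpar tau ^+ n).
Proof. by exists 1, 0 => tau _ _; rewrite mul1r normrX. Qed.

Lemma bigO_q_horner (R : realType) (P : {poly R[i]}) :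
  bigO_q 0 (fun tau => P.[qpar tau]).
Proof.
elim/poly_ind: P => [|P c IH].
  by under eq_fun do rewrite horner0; exact: bigO_q_cst.
under eq_fun do rewrite hornerMXaddC; apply: bigO_qD; last exact: bigO_q_cst.
by apply: (@bigO_q_le _ 0 (0 + 1)) => //; apply: bigO_qM => //; exact: bigO_q_qparX.
Qed.

Lemma bigO_q_divX (R : realType) (m n : nat) (g : R[i] -> R[i]) :
  bigO_q (m + n) (fun tau => qpar tau ^+ m * g tau) -> bigO_q n g.
Proof.
move=> [M [Y H]]; exists M, Y => tau tau0 Yt.
have q0 : 0 < `|qpar tau| ^+ m by rewrite exprn_gt0// normr_gt0 qpar_neq0.
by have := H _ tau0 Yt; rewrite normrM normrX exprD mulrCA ler_pM2l.
Qed.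

Lemma bigO_q1_cst (R : realType) (c : R[i]) : bigO_q 1 (fun _ => c) -> c = 0.
Proof.
move=> /bigO_qP[M [Y1 [M0 Y10 H]]]; apply/normr0_eq0/le_anti/andP; split => //.
have -> : `|c| = (complex.Re `|c|)%:C by rewrite (RRe_real (normr_real c)).
rewrite lecR; apply/ler_addgt0Pr => e e0; rewrite add0r -lecR.
rewrite (RRe_real (normr_real c)).
(* The radius e / (M + 1) gives M |q| <= e, and the added 1 keeps the denominator positive when M =
   0. *)
have [Y2 Y20 HY2] : exists2 Y : R, 0 < Y &
    forall tau, Y <= complex.Im tau -> `|qpar tau| <= (e / (M + 1))%:C.
  by apply: norm_qpar_le; rewrite divr_gt0// ltr_wpDl.
apply: le_trans (H (0 +i* Num.max Y1 Y2) _) _; first by rewrite /= le_max lexx.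
rewrite expr1; apply: le_trans (ler_wpM2l _ (HY2 _ _)) _.
- by rewrite ler0c.
- by rewrite /= le_max lexx orbT.
rewrite -rmorphM lecR/= mulrCA ger_pMr// ler_pdivrMr ?mul1r ?lerDl//.
by rewrite ltr_wpDl.
Qed.

(** Uniqueness of q-expansions: letting q tend to 0 kills the constant coefficient, and dividing by
    q then lowers [n] by one. *)
Lemma bigO_q_horner_coef (R : realType) (n : nat) (P : {poly R[i]}) :
  bigO_q n (fun tau => P.[qpar tau]) -> forall i, (i < n)%N -> P`_i = 0.
Proof.
elim: n P => // n IH; elim/poly_ind => [|P c _] H i; first by rewrite coef0.
have c0 : c = 0.
  apply: bigO_q1_cst.
  have : bigO_q 1 (fun tau => ((P * 'X + c%:P).[qpar tau]) + - P.[qpar tau] * qpar tau).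
    apply: bigO_qD; first exact: bigO_q_le H.
    apply: (@bigO_qM _ 0 1); last exact: bigO_q_qparX.
    by under eq_fun do rewrite -hornerN; exact: bigO_q_horner.
  by congr bigO_q; apply/funext => tau; rewrite hornerMXaddC; ring.
rewrite c0 addr0 coefMX in H *; case: i => //= i; rewrite ltnS => /IH; apply.
apply: (@bigO_q_divX _ 1); rewrite add1n.
by move: H; congr bigO_q; apply/funext => tau; rewrite hornerMX mulrC.
Qed.

(** A truncated q-expansion. The coefficients of [P] from degree [n] on are arbitrary, so sums and
    products need no truncation. *)
Definition qapprox (R : realType) (n : nat) (g : R[i] -> R[i]) (P : {poly R[i]}) :=
  bigO_q n (fun tau => g tau - P.[qpar tau]).

Lemma poly_drop1 (T : nzSemiRingType) (P : {poly T}) :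
  P`_0 = 1 -> P = 1 + 'X * drop_poly 1 P.
Proof.
move=> P0; apply/polyP => -[|i]; rewrite coefD coef1 coefXM ?addr0//=.
by rewrite add0r coef_drop_poly addn1.
Qed.

(** * Calculus of truncated q-expansions *)

Section QApprox.
Variables (R : realType) (n : nat).
Implicit Types (g h : R[i] -> R[i]) (P Q V : {poly R[i]}).

Lemma qapprox_bounded g P : qapprox n g P -> bigO_q 0 g.
Proof.
move=> gP; have -> : g = fun tau => (g tau - P.[qpar tau]) + P.[qpar tau].
  by apply/funext => tau; rewrite subrK.
by apply: bigO_qD; [exact: bigO_q_le gP | exact: bigO_q_horner].
Qed.

Lemma qapprox_horner P : qapprox n (fun tau => P.[qpar tau]) P.
Proof.
by exists 0, 0 => tau _ _; rewrite subrr normr0 mul0r.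
Qed.

Lemma qapprox_cst (c : R[i]) : qapprox n (fun _ => c) c%:P.
Proof.
have := qapprox_horner c%:P; congr qapprox.
by apply/funext => t; rewrite hornerC.
Qed.

Lemma qapproxD g h P Q : qapprox n g P -> qapprox n h Q ->
  qapprox n (fun tau => g tau + h tau) (P + Q).
Proof.
move=> gP hQ; have := bigO_qD gP hQ; congr bigO_q; apply/funext => t.
by rewrite hornerD; ring.
Qed.

Lemma qapproxM g h P Q : qapprox n g P -> qapprox n h Q ->
  qapprox n (fun tau => g tau * h tau) (P * Q).
Proof.
move=> gP hQ; have h0 := qapprox_bounded hQ.
have H1 := bigO_qM gP h0; have H2 := bigO_qM hQ (bigO_q_horner P).
rewrite !addn0 in H1 H2; have := bigO_qD H1 H2; congr bigO_q; apply/funext => t.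
by rewrite hornerM; ring.
Qed.

Lemma qapproxX g P m : qapprox n g P ->
  qapprox n (fun tau => g tau ^+ m) (P ^+ m).
Proof.
move=> gP; elim: m => [|m IH].
  by under eq_fun do rewrite expr0; rewrite expr0; exact: qapprox_cst.
by under eq_fun do rewrite exprS; rewrite exprS; exact: qapproxM.
Qed.

Lemma qapprox_sum (m : nat) (g : 'I_m -> R[i] -> R[i]) (P : 'I_m -> {poly R[i]}) :
  (forall i, qapprox n (g i) (P i)) ->
  qapprox n (fun tau => \sum_i g i tau) (\sum_i P i).
Proof.
elim: m g P => [|m IH] g P gP.
  by under eq_fun do rewrite big_ord0; rewrite big_ord0; exact: qapprox_cst.
under eq_fun do rewrite big_ord_recr/=; rewrite big_ord_recr/=.
by apply: qapproxD => //; apply: IH.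
Qed.

Lemma qapprox_coef g P Q : qapprox n g P -> qapprox n g Q ->
  forall i, (i < n)%N -> P`_i = Q`_i.
Proof.
move=> gP gQ i ni; apply/eqP; rewrite -subr_eq0 -coefB; apply/eqP.
have gN : qapprox n (fun tau => - 1 * g tau) ((-1)%:P * P).
  by apply: qapproxM => //; exact: qapprox_cst.
apply: (bigO_q_horner_coef _ ni).
have := bigO_qD gQ gN; congr bigO_q; apply/funext => t.
by rewrite hornerM hornerC hornerD hornerN; ring.
Qed.

(** Here g - 1 = O(q) tends to 0 at the cusp. The lower bound is what makes 1/g bounded there. *)
Lemma qapprox_ge_half g P : (0 < n)%N -> P`_0 = 1 -> qapprox n g P ->
  exists Y : R, forall tau, Y <= complex.Im tau -> 2^-1 <= `|g tau|.
Proof.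
move=> n0 P0 gP.
have g1 : bigO_q 1 (fun tau => g tau - 1).
  have PX := poly_drop1 P0.
  have H1 := bigO_qM (@bigO_q_qparX R 1) (bigO_q_horner (drop_poly 1 P)).
  have := bigO_qD (bigO_q_le n0 gP) H1; congr bigO_q; apply/funext => t.
  by rewrite {1}PX hornerD hornerM hornerC hornerX; ring.
have [M [Y1 [M0 Y10 HM]]] := bigO_qP g1.
have [Y2 Y20 HY2] : exists2 Y : R, 0 < Y &
    forall tau, Y <= complex.Im tau -> `|qpar tau| <= ((2 * (M + 1))^-1)%:C.
  by apply: norm_qpar_le; rewrite invr_gt0 mulr_gt0// ltr_wpDl.
exists (Num.max Y1 Y2) => tau; rewrite ge_max => /andP[Y1t Y2t].
have : `|1 - g tau| <= 2^-1.
  rewrite distrC; apply: le_trans (HM _ Y1t) _; rewrite expr1.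
  apply: le_trans (ler_wpM2l _ (HY2 _ Y2t)) _; first by rewrite ler0c.
  rewrite -rmorphM [X in _ <= X](_ : _ = (2^-1 : R)%:C); last first.
    by rewrite fmorphV rmorph_nat.
  rewrite lecR invfM mulrCA ger_pMr ?invr_gt0// ler_pdivrMr ?mul1r ?lerDl//.
  by rewrite ltr_wpDl.
have := lerB_dist 1 (g tau); rewrite normr1 => /le_trans /[apply].
rewrite lerBlDr -lerBlDl; congr (_ <= _).
by apply/eqP; rewrite subr_eq -[X in X + X]mul1r -splitr.
Qed.

Lemma qapprox_neq0 g P : (0 < n)%N -> P`_0 = 1 -> qapprox n g P ->
  exists Y : R, forall tau, Y <= complex.Im tau -> g tau != 0.
Proof.
move=> n0 P0 /(qapprox_ge_half n0 P0)[Y HY]; exists Y => tau /HY g12.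
by rewrite -normr_gt0; apply: lt_le_trans g12; rewrite invr_gt0.
Qed.

(** [V] inverts [P] modulo ['X^n], and 1/g - V(q) = (1/g) ((g - P(q)) (- V(q)) - q^n S(q)), where
    1/g is bounded near the cusp. *)
Lemma qapproxV g P V S : (0 < n)%N -> P`_0 = 1 -> P * V = 1 + 'X^n * S ->
  qapprox n g P -> qapprox n (fun tau => (g tau)^-1) V.
Proof.
move=> n0 P0 PV gP.
have [Y g12] := qapprox_ge_half n0 P0 gP.
have gV0 : bigO_q 0 (fun tau => (g tau)^-1).
  exists 2, Y => tau tau0 Yt.
  rewrite expr0 mulr1 normfV rmorph_nat -[2%:R]invrK lef_pV2 ?posrE ?g12//.
    by apply: lt_le_trans (g12 _ Yt); rewrite invr_gt0.
have H1 := bigO_qM gP (bigO_q_horner (- V)).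
have H2 := bigO_qM (@bigO_q_qparX R n) (bigO_q_horner (- S)).
rewrite !addn0 in H1 H2.
have := bigO_qM gV0 (bigO_qD H1 H2); apply: bigO_q_eq.
exists Y => tau tau0 Yt.
have gneq0 : g tau != 0.
  by rewrite -normr_gt0; apply: lt_le_trans (g12 _ Yt); rewrite invr_gt0.
have : (P * V).[qpar tau] = (1 + 'X^n * S).[qpar tau] by rewrite PV.
rewrite !(hornerM, hornerD, hornerC, hornerXn) => PVq.
apply: (mulfI gneq0); rewrite mulrA mulfV// mul1r mulrBr mulfV//.
rewrite !hornerN; ring: PVq.
Qed.

End QApprox.

(** * Expansions of the Eisenstein series and of the discriminant *)

(** Once |q| <= 1 / (2 b), the increments decay geometrically with ratio at most 1/2, so the limit
    differs from its [n]-th term by at most 2 A b^n |q|^n. *)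
Lemma clim_qapprox (R : realType) (P : nat -> {poly R[i]}) (A b r : R) :
  0 <= A -> 0 < b -> 0 < r ->
  (forall (z : R[i]) (x : R), `|z| = x%:C -> x <= r -> forall N, (0 < N)%N ->
    `|(P N.+1).[z] - (P N).[z]| <= (A * (b * x) ^+ N)%:C) ->
  forall n, (0 < n)%N ->
    qapprox n (fun tau => clim (fun N => (P N).[qpar tau])) (P n).
Proof.
move=> A0 b0 r0 HP n n0.
have [Y Y0 HY] : exists2 Y : R, 0 < Y &
    forall tau, Y <= complex.Im tau ->
      `|qpar tau| <= (Num.min r (2 * b)^-1)%:C.
  by apply: norm_qpar_le; rewrite lt_min r0 invr_gt0 mulr_gt0.
exists (2 * A * b ^+ n), Y => tau tau0 /HY.
rewrite !norm_qpar lecR le_min; set x := expR _ => /andP[xr xb].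
have x0 : 0 <= x by exact: expR_ge0.
rewrite -rmorphXn -rmorphM /= -[X in X%:C]mulrA -exprMn.
apply: (@clim_geometric_tail R (fun N => (P N).[qpar tau])) => //.
  rewrite mulr_ge0 ?(ltW b0)//= mulrC -ler_pdivlMr//.
  by rewrite mul1r -invfM.
by move=> m m0; apply: HP => //; rewrite norm_qpar.
Qed.

(** There are at most n divisors, each at most n, so the sum is at most n^(m+1), and n < 2^n. An
    exponential bound is the form that [clim_qapprox] consumes. *)
Lemma sigma_le (m n : nat) : (sigma m n <= (2 ^ m.+1) ^ n)%N.
Proof.
case: n => [|n]; first by rewrite /sigma /divisors /= big_seq1 /= exp1n.
apply: (@leq_trans (n.+1 ^ m.+1)); last first.
  by rewrite -expnM mulnC expnM leq_exp2r// ltnW// ltn_expl.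
rewrite expnS /sigma.
apply: (@leq_trans (\sum_(d <- divisors n.+1) n.+1 ^ m)%N).
  rewrite big_seq [X in (_ <= X)%N]big_seq leq_sum// => d dn.
  by case: m => // m; rewrite leq_exp2r// dvdn_leq// dvdn_divisors.
rewrite big_const_seq count_predT iter_addn_0 mulnC leq_mul2r; apply/orP; right.
rewrite -[X in (_ <= X)%N](size_iota 1); apply: uniq_leq_size.
  exact: divisors_uniq.
move=> d; rewrite -dvdn_divisors// mem_iota => dn.
apply/andP; split; first by case: d dn.
by rewrite add1n ltnS dvdn_leq.
Qed.

Lemma eisenstein_qapprox (R : realType) (k n : nat) : (0 < n)%N ->
  exists2 P : {poly R[i]}, P`_0 = 1 & qapprox n (eisenstein k) P.
Proof.
move=> n0; case: (eqVneq k 0%N) => [->|k0].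
  exists 1; first by rewrite coef1.
  by have := @qapprox_cst R n 1; congr qapprox; apply/funext => t;
    rewrite /eisenstein eqxx.
pose S N : {poly R[i]} := \sum_(1 <= n < N) (sigma k.-1 n)%:R *: 'X^n.
pose c : R[i] := - ((2 * k)%:R / ratr (bernoulli_number k)).
exists (1 + c%:P * S n).
  rewrite coefD coef1 coefCM coef_sum big1_seq ?mulr0 ?addr0// => i.
  rewrite mem_index_iota => /andP[_ /andP[i0 _]].
  by rewrite coefZ coefXn ltn_eqF// mulr0.
suff Sn : qapprox n (fun tau => clim (fun N => (S N).[qpar tau])) (S n).
  have := qapproxD (@qapprox_cst R n 1) (qapproxM (@qapprox_cst R n c) Sn).
  congr qapprox; apply/funext => t; rewrite /eisenstein (negbTE k0) /c mulNr.
  congr (_ - _ * clim _); apply/funext => N; rewrite horner_sum.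
  by apply: eq_bigr => i _; rewrite hornerZ hornerXn.
(* The base b = 2^(k-1+1) is the one supplied by [sigma_le]. *)
apply: (@clim_qapprox R S 1 (2 ^ k.-1.+1)%N%:R 1) => //.
move=> z x zx x1 N N0; rewrite /S big_nat_recr//= hornerD addrAC subrr add0r.
rewrite hornerZ hornerXn normrM normrX zx normr_nat mul1r exprMn -natrX.
rewrite rmorphM [X in _ <= _ * X]rmorphXn rmorph_nat -zx.
by rewrite ler_pM ?exprn_ge0 ?ler_nat ?sigma_le //= zx.
Qed.

(** For [m = 24] this is Delta / q. *)
Definition euler_pow (R : realType) (m : nat) (tau : R[i]) : R[i] :=
  clim (fun N => \prod_(1 <= n < N) (1 - qpar tau ^+ n) ^+ m).

(** Since |1 - y| <= 2, going from m to m + 1 turns a constant c into 2 c + 1, and 2 * 3^m + 1 <=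
    3^(m+1). *)
Lemma norm_sub1X_le (T : numDomainType) (y : T) (m : nat) : `|y| <= 1 ->
  `|(1 - y) ^+ m - 1| <= 3 ^+ m * `|y|.
Proof.
move=> y1; elim: m => [|m IH].
  by rewrite !expr0 subrr normr0 mul1r.
have -> : (1 - y) ^+ m.+1 - 1 = (1 - y) * ((1 - y) ^+ m - 1) - y.
  by rewrite exprS; ring.
apply: le_trans (ler_normB _ _) _; rewrite normrM.
have y2 : `|1 - y| <= 2.
  by apply: le_trans (ler_normB _ _) _; rewrite normr1 lerD2l.
apply: le_trans (lerD (ler_pM _ _ y2 IH) (lexx _)) _ => //.
rewrite -subr_ge0 exprS.
have -> : 3 * 3 ^+ m * `|y| - (2 * (3 ^+ m * `|y|) + `|y|) = (3 ^+ m - 1) * `|y|.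
  by ring.
by rewrite mulr_ge0// subr_ge0 exprn_ege1// ler1n.
Qed.

(** A bound by 2 alone would not pass the induction. With w = 2^(-N), the next factor is at most 1 +
    w^2, and (2 - 2 w)(1 + w^2) <= 2 - w because w <= 1/2. *)
Lemma norm_euler_le (T : numFieldType) (z : T) (m N : nat) : (0 < N)%N ->
  `|z| <= (4 * 3 ^+ m)^-1 ->
  `|\prod_(1 <= n < N) (1 - z ^+ n) ^+ m| <= 2 - 2 * 2^-1 ^+ N.
Proof.
move=> + zr; case: N => // N _; elim: N => [|N IH].
  by rewrite big_geq// normr1 expr1 mulfV// lerBrDr -[1]/(1%:R) -natrD.
have c0 : 0 < 3 ^+ m :> T by rewrite exprn_gt0.
have z14 : `|z| <= 4^-1.
  apply: le_trans zr _; rewrite lef_pV2 ?posrE ?mulr_gt0//.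
  by rewrite ler_peMr// exprn_ege1// ler1n.
have z1 : `|z| <= 1 by apply: le_trans z14 _; rewrite invf_le1// ler1n.
(* One factor |z| absorbs 3^m and leaves 1/4; each remaining factor is at most 1/4. *)
have zN : 3 ^+ m * `|z ^+ N.+1| <= 4^-1 ^+ N.+1.
  rewrite normrX !exprS mulrA ler_pM ?mulr_ge0 ?exprn_ge0//.
    by rewrite mulrC -ler_pdivlMr// -invfM.
  by apply: lerXn2r; rewrite ?nnegrE.
rewrite big_nat_recr//= normrM.
set p := \prod_(_ <= _ < _) _ in IH *.
have q1 : `|(1 - z ^+ N.+1) ^+ m| <= 1 + 4^-1 ^+ N.+1.
  rewrite -[_ ^+ m](subrK 1) addrC; apply: le_trans (ler_normD _ _) _.
  rewrite normr1 lerD2l; apply: le_trans _ zN; apply: norm_sub1X_le.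
  by rewrite normrX exprn_ile1.
apply: le_trans (ler_pM _ _ IH q1) _ => //.
have -> : 4^-1 = 2^-1 * 2^-1 :> T by rewrite -invfM -natrM.
rewrite exprMn [2^-1 ^+ N.+2]exprS mulVKf//.
set w := 2^-1 ^+ N.+1; rewrite -subr_ge0.
have w0 : 0 <= w by rewrite exprn_ge0// invr_ge0.
have w1 : w <= 2^-1.
  by rewrite /w exprS ler_piMr ?invr_ge0// exprn_ile1 ?invr_ge0// invf_le1// ler1n.
have -> : 2 - w - (2 - 2 * w) * (1 + w * w) = w * (1 - 2 * w) + 2 * w * w * w.
  by ring.
rewrite addr_ge0 ?mulr_ge0// subr_ge0.
by rewrite mulrC -ler_pdivlMr// mul1r.
Qed.

(** Only the factor (1 - q)^m contributes to the coefficient of q. Consecutive partial products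
    differ by a product bounded by 2 times (1 - q^N)^m - 1, which is at most 3^m |q|^N in absolute
    value. *)
Lemma euler_pow_qapprox (R : realType) (m n : nat) : (1 < n)%N ->
  exists P : {poly R[i]},
    [/\ P`_0 = 1, P`_1 = - m%:R & qapprox n (@euler_pow R m) P].
Proof.
move=> n1.
pose P N : {poly R[i]} := \prod_(1 <= i < N) (1 - 'X^i) ^+ m.
have coefM1 (p q : {poly R[i]}) : (p * q)`_1 = p`_0 * q`_1 + p`_1 * q`_0.
  by rewrite coefM !big_ord_recr big_ord0 /= add0r.
have coef0X (p : {poly R[i]}) j : p`_0 = 1 -> (p ^+ j)`_0 = 1.
  by move=> p0; elim: j => [|j IH]; rewrite ?expr0 ?coef1// exprS coef0M p0 IH mulr1.
have coef1X (p : {poly R[i]}) j : p`_0 = 1 -> (p ^+ j)`_1 = p`_1 *+ j.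
  move=> p0; elim: j => [|j IH]; first by rewrite expr0 coef1 mulr0n.
  by rewrite exprS coefM1 IH p0 mul1r coef0X// mulr1 mulrS addrC.
have P01 : (P n)`_0 = 1 /\ (P n)`_1 = - m%:R.
  case: n n1 => [|[|n]] // _; elim: n => [|n [IH0 IH1]].
    rewrite /P big_nat1 coef0X ?coef1X ?coefB ?coef1 ?coefXn ?subr0//=.
    by rewrite sub0r mulNrn.
  rewrite /P big_nat_recr//= -/(P _) coef0M coefM1 IH0 IH1.
  by rewrite coef0X ?coef1X ?coefB ?coef1 ?coefXn ?subr0//= mul0rn !mulr1 mulr0 add0r.
exists (P n); split; [by case: P01|by case: P01|].
have -> : @euler_pow R m = (fun tau => clim (fun N => (P N).[qpar tau])).
  apply/funext => tau; congr clim; apply/funext => N; rewrite horner_prod.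
  by apply: eq_bigr => i _; rewrite horner_exp hornerD hornerN hornerXn hornerC.
apply: (@clim_qapprox R P (2 * 3 ^+ m) 1 (4 * 3 ^+ m)^-1) => //; last exact: ltnW.
move=> z x zx xr N N0; rewrite /P big_nat_recr//= hornerM.
rewrite -{2}[(\prod_(_ <= _ < _) _).[z]]mulr1 -mulrBr.
have -> : (P N).[z] = \prod_(1 <= n < N) (1 - z ^+ n) ^+ m.
  rewrite horner_prod; apply: eq_bigr => i _.
  by rewrite horner_exp hornerD hornerN hornerXn hornerC.
have zr : `|z| <= (4 * 3 ^+ m)^-1.
  rewrite zx (_ : (4 * 3 ^+ m)^-1 = ((4 * 3 ^+ m)^-1 : R)%:C) ?lecR//.
  by rewrite fmorphV rmorphM rmorphXn !rmorph_nat.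
have z1 : `|z| <= 1.
  apply: le_trans zr _; rewrite invf_le1 ?mulr_gt0 ?exprn_gt0//.
  by rewrite mulr_ege1 ?exprn_ege1 ?ler1n.
have -> : (2 * 3 ^+ m * (1 * x) ^+ N)%:C = 2 * (3 ^+ m * `|z ^+ N|).
  by rewrite normrX zx mul1r !rmorphM !rmorphXn !rmorph_nat mulrA.
rewrite normrM; apply: ler_pM => //.
  apply: le_trans (norm_euler_le N0 zr) _.
  by rewrite gerBl mulr_ge0// exprn_ge0// invr_ge0.
rewrite horner_exp hornerD hornerN hornerXn hornerC.
by apply: norm_sub1X_le; rewrite normrX exprn_ile1.
Qed.

(** * Asymptotics of the coefficients of a Faber polynomial *)

Lemma sum_ord_trunc (T : nmodType) (F : nat -> T) (m n : nat) :
  (m <= n)%N -> (forall i, (m <= i < n)%N -> F i = 0) ->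
  \sum_(i < n) F i = \sum_(i < m) F i.
Proof.
move=> mn F0; rewrite -!(big_mkord xpredT F) (@big_cat_nat _ _ _ m)//=.
have -> : \sum_(m <= i < n) F i = 0; last by rewrite addr0.
by apply: big1_seq => i; rewrite mem_index_iota => /andP[_ /F0].
Qed.

Lemma ffact_le_expn (n m : nat) : (n ^_ m <= n ^ m)%N.
Proof.
elim: m => [|m IH]; first by rewrite ffactn0.
by rewrite ffactnSr expnSr leq_mul// leq_subr.
Qed.

(** This says n^m - n^_m = O(n^(m-1)), multiplied by n and written without subtraction. The
    induction uses n <= (n - m) + m, valid for truncated subtraction too. *)
Lemma expn_le_ffact (n m : nat) :
  (n * n ^ m <= n * n ^_ m + m ^ 2 * n ^ m)%N.
Proof.
elim: m => [|m IH]; first by rewrite ffactn0 addn0.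
have H1 : (n * n ^_ m <= n ^_ m.+1 + m * n ^ m)%N.
  have nm : (n <= (n - m) + m)%N by rewrite addnC -leq_subLR leqnn.
  apply: leq_trans (leq_mul nm (leqnn _)) _; rewrite mulnDl ffactnSr.
  by rewrite [X in (X + _ <= _)%N]mulnC leq_add2l leq_mul// ffact_le_expn.
have := leq_mul (leqnn n) IH; have := leq_mul (leqnn n) H1.
have -> : (m.+1 ^ 2 = m ^ 2 + 2 * m + 1)%N by rewrite -addn1 sqrnD; lia.
rewrite (expnS n m); move: (n ^ m)%N (n ^_ m)%N (n ^_ m.+1)%N (m ^ 2)%N => a b c d H3 H4.
have := leq0n (m * (n * a)); have := leq0n (n * a); lia.
Qed.

Section FaberCoef.
Variable T : numFieldType.
Implicit Types (A F J V : {poly T}) (W : nat -> {poly T}).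

(** An error O(l^(s-1)) is expressed here and below by multiplying it by l, so that s = 0 needs no
    negative exponent. *)
Lemma bin_asymp (l s : nat) : (0 < l)%N ->
  l%:R * `|'C(l, s)%:R - l%:R ^+ s / s`!%:R| <= (s ^ 2)%N%:R * l%:R ^+ s :> T.
Proof.
move=> l0; have f0 : 0 < s`!%:R :> T by rewrite ltr0n fact_gt0.
have -> : 'C(l, s)%:R - l%:R ^+ s / s`!%:R =
    - ((l%:R ^+ s - (l ^_ s)%:R) / s`!%:R) :> T.
  by rewrite -bin_ffact natrM mulrBl mulfK ?gt_eqF// opprB.
rewrite normrN -natrX -natrB ?ffact_le_expn// ger0_norm ?divr_ge0//.
rewrite mulrA ler_pdivrMr// -!natrM ler_nat mulnBr leq_subLR.
apply: leq_trans (expn_le_ffact l s) _; rewrite leq_add2l.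
by rewrite leq_pmulr// fact_gt0.
Qed.

(** Write V = 1 + X U and expand by the binomial theorem; the term X^j U^j reaches degree s only for
    j <= s. *)
Lemma coef_exp_binomial V (l s : nat) : V`_0 = 1 ->
  (V ^+ l)`_s =
    \sum_(j < s.+1) (drop_poly 1 V ^+ j)`_(s - j) * 'C(l, j)%:R.
Proof.
move=> V0; have VX := poly_drop1 V0; set U := drop_poly 1 V in VX *.
pose G j := ('X^j * U ^+ j)`_s * 'C(l, j)%:R.
have -> : (V ^+ l)`_s = \sum_(j < l.+1) G j.
  rewrite VX exprDn coef_sum; apply: eq_bigr => j _.
  by rewrite expr1n mul1r coefMn exprMn /G mulr_natr.
(* Padding the range to l + 1 + s + 1 before cutting it to s + 1 avoids comparing l with s: the
   binomial vanishes beyond l, the coefficient beyond s. *)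
rewrite -(@sum_ord_trunc _ G _ (l.+1 + s.+1)) ?leq_addr//; last first.
  by move=> i /andP[li _]; rewrite /G bin_small// mulr0.
rewrite (@sum_ord_trunc _ G s.+1) ?leq_addl//; last first.
  by move=> i /andP[si _]; rewrite /G coefXnM si mul0r.
by apply: eq_bigr => j _; rewrite /G coefXnM ltnNge -ltnS ltn_ord.
Qed.

(** The term j = s is V_1^s times a binomial, handled by [bin_asymp]; the terms j < s are O(l^j),
    hence O(l^(s-1)). *)
Lemma coef_exp_asymp V (s : nat) : V`_0 = 1 ->
  exists2 K : T, 0 <= K & forall l : nat, (0 < l)%N ->
    l%:R * `|(V ^+ l)`_s - (V`_1 * l%:R) ^+ s / s`!%:R| <= K * l%:R ^+ s.
Proof.
move=> V0; set U := drop_poly 1 V.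
exists ((s ^ 2)%N%:R * `|V`_1| ^+ s + \sum_(j < s) `|(U ^+ j)`_(s - j)|).
  by rewrite addr_ge0 ?mulr_ge0 ?exprn_ge0 ?sumr_ge0.
move=> l l0; rewrite coef_exp_binomial// -/U big_ord_recr/= subnn.
have -> : (U ^+ s)`_0 = V`_1 ^+ s.
  by rewrite -horner_coef0 horner_exp horner_coef0 coef_drop_poly.
rewrite exprMn -addrA -mulrA -mulrBr mulrDl addrC.
apply: le_trans (ler_wpM2l _ (ler_normD _ _)) _ => //.
rewrite mulrDr lerD//.
  rewrite normrM normrX mulrCA mulrAC [X in _ <= X]mulrC.
  by rewrite ler_wpM2l ?exprn_ge0// bin_asymp.
apply: le_trans (ler_wpM2l _ (ler_norm_sum _ _ _)) _ => //.
rewrite mulr_sumr mulr_suml ler_sum// => j _.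
rewrite normrM mulrCA ler_wpM2l// normr_nat -natrM -natrX ler_nat.
apply: (@leq_trans (l ^ j.+1)); last by rewrite leq_pexp2l.
rewrite expnS leq_mul2l (leq_trans _ (ffact_le_expn l j)) ?orbT//.
by rewrite -bin_ffact leq_pmulr// fact_gt0.
Qed.

Lemma norm_le_of_asymp (x v K : T) (l s : nat) : (0 < l)%N ->
  l%:R * `|x - (v * l%:R) ^+ s / s`!%:R| <= K * l%:R ^+ s ->
  `|x| <= (K + `|v| ^+ s) * l%:R ^+ s.
Proof.
move=> l0 H; rewrite -[x](subrK ((v * l%:R) ^+ s / s`!%:R)) mulrDl.
apply: le_trans (ler_normD _ _) _; apply: lerD.
  by apply: le_trans H; rewrite ler_peMl// ler1n.
rewrite normrM normfV normr_nat normrX normrM normr_nat exprMn.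
by rewrite ler_pdivrMr ?ltr0n ?fact_gt0// ler_peMr ?ler1n ?fact_gt0// mulr_ge0 ?exprn_ge0.
Qed.

(** Uniformity in k' holds because only finitely many [W k'] occur: [w i] dominates all their i-th
    coefficients. *)
Lemma coefM_bounded W (C : T) (B m : nat) : 0 <= C ->
  exists2 K : T, 0 <= K & forall k' A, (k' <= B)%N ->
    (forall j, (j <= m)%N -> `|A`_j| <= C) -> `|(A * W k')`_m| <= K.
Proof.
move=> C0; pose w i := \sum_(k < B.+1) `|(W k)`_i|.
have w0 i : 0 <= w i by exact: sumr_ge0.
exists (\sum_(i < m.+1) C * w (m - i)%N).
  by apply: sumr_ge0 => i _; rewrite mulr_ge0.
move=> k' A kB AC; rewrite coefM; apply: le_trans (ler_norm_sum _ _ _) _.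
apply: ler_sum => i _; rewrite normrM ler_pM//; first by rewrite AC// -ltnS.
rewrite -ltnS in kB; rewrite /w (bigD1 (Ordinal kB))//= lerDl.
exact: sumr_ge0.
Qed.

(* [V], [J] and [W k'] stand for q/Delta, q j and 1/E_k'. *)
Lemma faber_coef_asymp (D B : nat) (C : T) V J W : 0 <= C ->
  V`_0 = 1 -> J`_0 = 1 -> (forall k', (W k')`_0 = 1) ->
  forall s, (s <= D)%N -> exists2 K : T, 0 <= K &
    forall (l k' : nat) A F, (0 < l)%N -> (k' <= B)%N -> A`_0 = 1 ->
      (forall j, (j <= D)%N -> `|A`_j| <= C) ->
      (forall m, (m <= D)%N ->
        \sum_(r < m.+1) F`_(D - r) * (J ^+ (D - r))`_(m - r) =
        (V ^+ l * (A * W k'))`_m) ->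
      l%:R * `|F`_(D - s) - (V`_1 * l%:R) ^+ s / s`!%:R| <= K * l%:R ^+ s.
Proof.
move=> C0 V0 J0 W0; elim/ltn_ind => s IH sD.
have /choice[KV HKV] i : exists K : T, 0 <= K /\ forall l : nat, (0 < l)%N ->
    `|(V ^+ l)`_i| <= K * l%:R ^+ i.
  have [K K0 HK] := coef_exp_asymp i V0.
  exists (K + `|V`_1| ^+ i); split; first by rewrite addr_ge0 ?exprn_ge0.
  by move=> l l0; apply: norm_le_of_asymp => //; exact: HK.
have /choice[KW HKW] i : exists K : T, 0 <= K /\ forall k' A, (k' <= B)%N ->
    (forall j, (j <= i)%N -> `|A`_j| <= C) -> `|(A * W k')`_i| <= K.
  by have [K] := coefM_bounded W B i C0; exists K.
(* The induction hypothesis, weakened to a bound O(l^r) on the earlier coefficients. For r >= s the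
   claim is vacuous, so the constant 0 serves. *)
have /choice[KF HKF] r : exists K : T, 0 <= K /\
    forall (l k' : nat) A F, (0 < l)%N -> (k' <= B)%N -> A`_0 = 1 ->
      (forall j, (j <= D)%N -> `|A`_j| <= C) ->
      (forall m, (m <= D)%N ->
        \sum_(r < m.+1) F`_(D - r) * (J ^+ (D - r))`_(m - r) =
        (V ^+ l * (A * W k'))`_m) ->
      (r < s)%N -> `|F`_(D - r)| <= K * l%:R ^+ r.
  have [rs|] := ltnP r s; last by exists 0.
  have [K K0 HK] := IH r rs (leq_trans (ltnW rs) sD).
  exists (K + `|V`_1| ^+ r); split; first by rewrite addr_ge0 ?exprn_ge0.
  move=> l k' A F l0 kB A0 AC AF _; apply: norm_le_of_asymp => //.
  exact: HK AF.
have [K1 K10 HK1] := coef_exp_asymp s V0.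
exists (K1 + \sum_(i < s) KV i * KW (s - i)%N
       + \sum_(i < s) KF i * `|(J ^+ (D - i))`_(s - i)|).
  rewrite !addr_ge0 ?sumr_ge0// => i _; rewrite mulr_ge0//.
  - by case: (HKV i).
  - by case: (HKW (s - i)%N).
  - by case: (HKF i).
move=> l k' A F l0 kB A0 AC AF; have := AF s sD.
have coef0J m : (J ^+ m)`_0 = 1.
  by rewrite -horner_coef0 horner_exp horner_coef0 J0 expr1n.
rewrite coefM !big_ord_recr/= subnn coef0J coef0M A0 W0 !mulr1 => Fs.
have -> : F`_(D - s) = (V ^+ l)`_s + \sum_(i < s) (V ^+ l)`_i * (A * W k')`_(s - i)
    - \sum_(r < s) F`_(D - r) * (J ^+ (D - r))`_(s - r).
  by apply/eqP; rewrite eq_sym subr_eq [eqbRHS]addrC Fs addrC.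
have rearr (a b c d : T) : a + b - c - d = (a - d) + b - c by ring.
rewrite rearr.
apply: le_trans (ler_wpM2l _ (ler_normB _ _)) _ => //.
rewrite mulrDr [leRHS]mulrDl; apply: lerD.
  apply: le_trans (ler_wpM2l _ (ler_normD _ _)) _ => //.
  rewrite mulrDr [leRHS]mulrDl; apply: lerD; first exact: HK1.
  apply: le_trans (ler_wpM2l _ (ler_norm_sum _ _ _)) _ => //.
  rewrite mulr_sumr mulr_suml ler_sum// => i _.
  have [KV0 /(_ _ l0) HV] := HKV i; have [KW0 HW] := HKW (s - i)%N.
  have {}HW := HW k' A kB (fun j ji => AC j (leq_trans ji (leq_trans (leq_subr _ _) sD))).
  rewrite normrM; apply: le_trans (ler_wpM2l _ (ler_pM _ _ HV HW)) _ => //.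
  rewrite [leLHS](_ : _ = KV i * KW (s - i)%N * l%:R ^+ i.+1); last first.
    by rewrite exprS; ring.
  by rewrite ler_wpM2l ?mulr_ge0// ler_weXn2l// ler1n.
apply: le_trans (ler_wpM2l _ (ler_norm_sum _ _ _)) _ => //.
rewrite mulr_sumr mulr_suml ler_sum// => i _.
have [KF0 HF] := HKF i; have {}HF := HF l k' A F l0 kB A0 AC AF (ltn_ord i).
rewrite normrM; apply: le_trans (ler_wpM2l _ (ler_wpM2r _ HF)) _ => //.
rewrite [leLHS](_ : _ = KF i * `|(J ^+ (D - i))`_(s - i)| * l%:R ^+ i.+1).
  by rewrite ler_wpM2l ?mulr_ge0// ler_weXn2l// ler1n.
by rewrite exprS; ring.
Qed.

End FaberCoef.

(** * The triangular system satisfied by a Faber polynomial *)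

(** Truncated geometric series in 1 - P, which is divisible by X. *)
Lemma poly_inv_mod (T : comNzRingType) (P : {poly T}) (n : nat) :
  (0 < n)%N -> P`_0 = 1 ->
  exists V S : {poly T}, P * V = 1 + 'X^n * S /\ V`_0 = 1.
Proof.
move=> n0 P0; have PX : 1 - P = 'X * - drop_poly 1 P.
  by rewrite {1}(poly_drop1 P0) opprD addrA subrr add0r mulrN.
exists (\sum_(i < n) (1 - P) ^+ i), (- (- drop_poly 1 P) ^+ n).
have PV : P * \sum_(i < n) (1 - P) ^+ i = 1 - (1 - P) ^+ n.
  have := subrX1 (1 - P) n; rewrite [1 - P - 1]addrAC subrr add0r mulNr.
  by move=> /(congr1 -%R); rewrite opprB opprK => ->.
have PVX : P * \sum_(i < n) (1 - P) ^+ i = 1 + 'X^n * - (- drop_poly 1 P) ^+ n.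
  by rewrite PV {1}PX exprMn mulrN.
split => //; have := congr1 (fun p : {poly T} => p`_0) PVX.
by rewrite coef0M P0 mul1r coefD coef1 coefXnM n0 addr0.
Qed.

Lemma coef_comp_scaleX (T : comNzRingType) (p : {poly T}) (c : T) (m : nat) :
  (p \Po (c *: 'X))`_m = p`_m * c ^+ m.
Proof.
rewrite comp_polyE.
under eq_bigr do rewrite exprZn scalerA.
rewrite -(poly_def (size p) (fun i => p`_i * c ^+ i)) coef_poly.
by case: ltnP => // /(nth_default 0) ->; rewrite mul0r.
Qed.

Section FaberExpansion.
Variables (R : realType) (D M l k' : nat).
Variables (f : R[i] -> R[i]) (a : nat -> R[i]) (F V G W : {poly R[i]}).
Hypotheses (DM : (D <= M)%N) (Dl : (D <= l)%N).
Hypotheses (V0 : V`_0 = 1) (G0 : G`_0 = 1) (W0 : W`_0 = 1).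
Hypothesis approxV : qapprox M.+1 (fun tau => (euler_pow 24 tau)^-1) V.
Hypothesis approxG : qapprox M.+1 (@eisenstein R 4) G.
Hypothesis approxW : qapprox M.+1 (fun tau => (eisenstein k' tau)^-1) W.
Hypothesis fA : bigO_q (l + 1) (fun tau =>
  f tau - qpar tau ^+ (l - D) * (1 + \sum_(1 <= j < D.+1) a j * qpar tau ^+ j)).
Hypothesis faber : is_faber_poly l k' f F.
Hypothesis sizeF : (size F <= M.+1)%N.

Let A : {poly R[i]} := 1 + \sum_(1 <= j < D.+1) a j *: 'X^j.

(** [M] is an a priori bound for the degree of [F], so q^M clears the pole of F(j). A large [M]
    yields the degree bound [D]; [M = D] then gives the coefficient system. *)
Let g (tau : R[i]) := qpar tau ^+ M * F.[klein_j tau].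

(** Term by term, q^M j^(M-r) = (q j)^(M-r) q^r, and q j = E_4^3 / (Delta/q) expands as G^3 V. *)
Lemma faber_qapprox_polar :
  qapprox M.+1 g (\sum_(r < M.+1) F`_(M - r) *: ((G ^+ 3 * V) ^+ (M - r) * 'X^r)).
Proof.
have -> : g = fun tau => \sum_(r < M.+1) F`_(M - r) *
    ((eisenstein 4 tau ^+ 3 * (euler_pow 24 tau)^-1) ^+ (M - r) * qpar tau ^+ r).
  apply/funext => tau; rewrite /g (horner_coef_wide _ sizeF) mulr_sumr.
  rewrite (reindex_inj rev_ord_inj)/=; apply: eq_bigr => r _.
  rewrite subSS mulrCA; congr (_ * _).
  have rM : (r <= M)%N by rewrite -ltnS.
  rewrite -{1}(subnK rM) exprD mulrAC -exprMn; congr (_ ^+ _ * _).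
  rewrite /klein_j /modular_discriminant -/(euler_pow 24 tau) invfM.
  by rewrite mulrCA [X in _ * X]mulrA mulfV ?qpar_neq0// mul1r.
apply: qapprox_sum => r; rewrite -mul_polyC; apply: qapproxM.
  exact: qapprox_cst.
apply: qapproxM.
  by apply: qapproxX; apply: qapproxM => //; exact: qapproxX.
by have := qapprox_horner M.+1 ('X^r : {poly R[i]}); congr qapprox;
  apply/funext => t; rewrite hornerXn.
Qed.

(** Dividing f by Delta^l E_k' gives q^M F(j) = q^(M-D) (f / q^(l-D)) (Delta/q)^(-l) / E_k'. The
    last three factors are known up to O(q^(D+1)), and q^(M-D) raises this to O(q^(M+1)). *)
Lemma faber_qapprox_form :
  qapprox M.+1 g ('X^(M - D) * (V ^+ l * (A * W))).
Proof.
(* As the inverse of 0 is 0, nonvanishing of these inverses near the cusp yields that of Delta/q and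
   E_k', which the final cancellation needs. *)
have [Y1 HY1] := qapprox_neq0 (ltn0Sn M) V0 approxV.
have [Y2 HY2] := qapprox_neq0 (ltn0Sn M) W0 approxW.
have hA : qapprox D.+1 (fun tau => f tau / qpar tau ^+ (l - D)) A.
  apply: (@bigO_q_divX _ (l - D)); rewrite addnS subnK// -addn1.
  move: fA; congr bigO_q; apply/funext => tau.
  rewrite mulrBr mulrCA mulfV ?expf_neq0 ?qpar_neq0// mulr1; congr (_ - _ * _).
  rewrite /A hornerD hornerC horner_sum; congr (_ + _); apply: eq_bigr => j _.
  by rewrite hornerZ hornerXn.
have aV : qapprox D.+1 (fun tau => (euler_pow 24 tau)^-1) V by exact: bigO_q_le approxV.
have aW : qapprox D.+1 (fun tau => (eisenstein k' tau)^-1) W by exact: bigO_q_le approxW.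
have := qapproxM (qapproxX l aV) (qapproxM hA aW).
move=> /(bigO_qM (@bigO_q_qparX R (M - D))); rewrite addnS subnK//.
apply: bigO_q_eq; exists (Num.max Y1 Y2) => tau tau0.
rewrite ge_max => /andP[/HY1 + /HY2].
rewrite !invr_eq0 => e0 E0.
rewrite [in RHS]hornerM hornerXn mulrBr; congr (_ - _); rewrite /g faber//.
rewrite /modular_discriminant -/(euler_pow 24 tau).
have q0 := qpar_neq0 tau; move: e0 E0 q0.
move: (euler_pow 24 tau) (eisenstein k' tau) (qpar tau) (F.[_]) => e E q y e0 E0 q0.
have qM : q ^+ M = q ^+ (M - D) * q ^+ D by rewrite -exprD subnK.
have ql : q ^+ l = q ^+ (l - D) * q ^+ D by rewrite -exprD subnK.
rewrite exprVn exprMn qM ql.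
move: (expf_neq0 l e0) (expf_neq0 (l - D) q0).
move: (e ^+ l) (q ^+ D) (q ^+ (l - D)) (q ^+ (M - D)) => e1 q1 q2 q3 h1 h2.
by field; rewrite h1 h2 E0.
Qed.

Lemma faber_coef_system (s : nat) : (s <= M)%N ->
  \sum_(r < s.+1) F`_(M - r) * ((G ^+ 3 * V) ^+ (M - r))`_(s - r) =
  ('X^(M - D) * (V ^+ l * (A * W)))`_s.
Proof.
move=> sM; rewrite -(qapprox_coef faber_qapprox_polar faber_qapprox_form)//.
pose H r := (F`_(M - r) *: ((G ^+ 3 * V) ^+ (M - r) * 'X^r))`_s.
rewrite coef_sum (@sum_ord_trunc _ H s.+1 M.+1)//; last first.
  by move=> i /andP[si _]; rewrite /H coefZ coefMXn si mulr0.
apply: eq_bigr => r _; rewrite /H coefZ coefMXn.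
by rewrite ltnNge -ltnS ltn_ord.
Qed.

(** The right side of the system is divisible by X^(M-D), so its first M - D equations are
    homogeneous and, being unitriangular, force zeros. *)
Lemma faber_coef_eq0 (m : nat) : (m < M - D)%N -> F`_(M - m) = 0.
Proof.
elim/ltn_ind: m => m IH mMD.
have mM : (m <= M)%N by rewrite (leq_trans (ltnW mMD))// leq_subr.
have := faber_coef_system mM; rewrite coefXnM mMD big_ord_recr/= big1 ?add0r.
  rewrite subnn; have -> : ((G ^+ 3 * V) ^+ (M - m))`_0 = 1; last by rewrite mulr1.
  by rewrite -horner_coef0 horner_exp hornerM horner_exp !horner_coef0 G0 V0 !(expr1n, mulr1).
by move=> i _; rewrite IH ?mul0r// (ltn_trans (ltn_ord i)).
Qed.

Lemma size_faber_poly : (size F <= D.+1)%N.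
Proof.
apply/leq_sizeP => i Di; have [iM|Mi] := leqP i M.
  by rewrite -(subKn iM) faber_coef_eq0//; lia.
by rewrite nth_default// (leq_trans sizeF).
Qed.

End FaberExpansion.

(** * From powers of 24 l to powers of 2k, and the final estimate *)

Lemma expn_le_shift (a b c s : nat) : (a <= b <= a + c)%N ->
  (b * b ^ s <= b * a ^ s + c * s * b ^ s)%N.
Proof.
move=> /andP[ab bac]; elim: s => [|s IH]; first by rewrite !expn0 leq_addr.
have H1 := leq_mul (leqnn b) IH.
have H2 : (a ^ s <= b ^ s)%N by case: s {IH H1} => // s; rewrite leq_exp2r.
have H3 := leq_mul bac (leqnn (a ^ s)); have H4 := leq_mul (leqnn c) H2.
rewrite !expnS; move: (a ^ s)%N (b ^ s)%N H1 H2 H3 H4 => x y H1 _ H3 H4.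
(* Replacing one factor b by a costs at most c a^s <= c b^s; this happens once per induction step,
   whence the factor s. *)
have H5 : (b * (b * x) <= b * (a * x + c * y))%N.
  by rewrite leq_mul// (leq_trans H3)// mulnDl leq_add2l.
lia.
Qed.

(** From 2k = 24 l + 2k' with k' <= 14 come 28 = 2 * 14, bounding 2k - 24 l, and 26 = 12 + 14, since
    k <= 26 l for l >= 1. The two summands bound the error in x and the change from (24 l)^s to
    (2k)^s. *)
Lemma weight_asymp (T : numFieldType) (x K : T) (k l k' s : nat) :
  0 <= K -> (0 < l)%N -> (k' <= 14)%N -> k = (12 * l + k')%N ->
  l%:R * `|x - (24%:R * l%:R) ^+ s / s`!%:R| <= K * l%:R ^+ s ->
  `|s`!%:R * x / (2 * k)%:R ^+ s - 1| <= (26%:R * s`!%:R * K + (28 * s)%:R) / k%:R.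
Proof.
move=> K0 l0 k14 kE H.
have k0 : 0 < k%:R :> T by rewrite ltr0n; lia.
have b0 : 0 < (2 * k)%:R ^+ s :> T by rewrite exprn_gt0// ltr0n; lia.
have f0 : 0 < s`!%:R :> T by rewrite ltr0n fact_gt0.
rewrite ler_pdivlMr//.
have -> : s`!%:R * x / (2 * k)%:R ^+ s - 1 =
    (s`!%:R * x - (2 * k)%:R ^+ s) / (2 * k)%:R ^+ s.
  by rewrite mulrBl mulfV ?gt_eqF.
rewrite normrM normfV (gtr0_norm b0) mulrAC ler_pdivrMr//.
have -> : s`!%:R * x - (2 * k)%:R ^+ s =
    s`!%:R * (x - (24%:R * l%:R) ^+ s / s`!%:R)
    - ((2 * k)%:R ^+ s - (24%:R * l%:R) ^+ s).
  by rewrite mulrBr mulrCA mulfV ?gt_eqF// mulr1 opprB addrA subrK.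
apply: le_trans (ler_wpM2r (ltW k0) (ler_normB _ _)) _.
rewrite mulrDl [leRHS]mulrDl; apply: lerD.
  rewrite normrM (gtr0_norm f0).
  apply: (@le_trans _ _ (s`!%:R * `|x - (24%:R * l%:R) ^+ s / s`!%:R| * (26%:R * l%:R))).
    by rewrite ler_wpM2l ?mulr_ge0 ?(ltW f0)// -natrM ler_nat; lia.
  set N := `|_| in H *.
  rewrite [leLHS](_ : _ = 26%:R * s`!%:R * (l%:R * N)); last by ring.
  rewrite [leRHS](_ : _ = 26%:R * s`!%:R * (K * (2 * k)%:R ^+ s)); last by ring.
  rewrite ler_wpM2l ?mulr_ge0 ?(ltW f0)//; apply: le_trans H _.
  rewrite ler_wpM2l//; apply: lerXn2r; rewrite ?nnegrE// ler_nat; lia.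
have ab : (24 * l <= 2 * k <= 24 * l + 28)%N by lia.
have := expn_le_shift s ab; rewrite -natrM -!natrX => Hab.
have abs : ((24 * l) ^ s <= (2 * k) ^ s)%N.
  by case: s {H b0 f0 Hab} => // s; rewrite leq_exp2r//; lia.
rewrite -natrB// normr_nat -!natrM ler_nat mulnBl leq_subLR.
move: Hab abs; set u := ((24 * l) ^ s)%N; set v := ((2 * k) ^ s)%N => Hab abs.
have := leq_mul (leqnn k) abs; lia.
Qed.

Lemma inv_eisenstein_qapprox (R : realType) (k n : nat) : (0 < n)%N ->
  exists W : {poly R[i]},
    W`_0 = 1 /\ qapprox n (fun tau => (eisenstein k tau)^-1) W.
Proof.
move=> n0; have [P P0 EP] := eisenstein_qapprox R k n0.
have [W [S [PW W0]]] := poly_inv_mod n0 P0.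
by exists W; split => //; exact: qapproxV PW EP.
Qed.

(** The coefficient of X in P V = 1 + X^n S gives V_1 = - P_1 = m; for [m = 24] this is the source
    of the 24 l in the asymptotics. *)
Lemma inv_euler_pow_qapprox (R : realType) (m n : nat) : (1 < n)%N ->
  exists V : {poly R[i]}, [/\ V`_0 = 1, V`_1 = m%:R
    & qapprox n (fun tau => (euler_pow m tau)^-1) V].
Proof.
move=> n1; have n0 := ltnW n1; have [P [P0 P1 EP]] := euler_pow_qapprox R m n1.
have [V [S [PV V0]]] := poly_inv_mod n0 P0.
exists V; split => //; last exact: qapproxV PV EP.
have := congr1 (fun p : {poly R[i]} => p`_1) PV.
rewrite coefM !big_ord_recr big_ord0/= add0r P0 P1 V0 mul1r mulr1.
rewrite coefD coef1 coefXnM n1 addr0 => /eqP.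
by rewrite subr_eq0 => /eqP.
Qed.

Unset Implicit Arguments.

Theorem theorem1p2 (R : realType) (D : nat) (C : R) (hD : (1 <= D)%N) (hC : 0 < C) :
  exists2 K : R, 0 < K &
    forall (k l k' : nat) (f : R[i] -> R[i]) (a : nat -> R[i]) (F : {poly R[i]}),
      ~~ odd k ->
      k = (12 * l + k')%N ->
      k' \in [:: 0; 4; 6; 8; 10; 14]%N ->
      (D + 1 <= l)%N ->
      cusp_form k f ->
      bigO_q (l + 1) (fun tau =>
        f tau - qpar tau ^+ (l - D) * (1 + \sum_(1 <= j < D.+1) a j * qpar tau ^+ j)) ->
      (forall j : nat, (1 <= j <= D)%N -> `|a j| <= C%:C) ->
      is_faber_poly l k' f F ->
      forall s : nat, (s <= D)%N ->
        exists2 eps : R[i], `|eps| <= (K / k%:R)%:C &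
          (((2 * k)%:R ^+ D)^-1 *: (F \Po ((2 * k)%:R *: 'X)))`_(D - s)
            = (s`!%:R)^-1 * (1 + eps).
Proof.
(* These expansions are fixed before k and f, so every constant derived from them depends only on D
   and C. *)
have [V [V0 V1 aV]] := @inv_euler_pow_qapprox R 24 D.+1 hD.
have [G G0 aG] := @eisenstein_qapprox R 4 D.+1 isT.
have /choice[W HW] k' := @inv_eisenstein_qapprox R k' D.+1 isT.
have W0 k' : (W k')`_0 = 1 by case: (HW k').
have J0 : (G ^+ 3 * V)`_0 = 1.
  by rewrite -horner_coef0 hornerM horner_exp !horner_coef0 G0 V0 !(expr1n, mulr1).
(* The bound 1 + C covers both the leading coefficient 1 and the a(j). *)
have C0 : 0 <= 1 + C%:C :> R[i] by rewrite addr_ge0// ler0c ltW.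
have /choice[Ks HKs] s : exists K : R[i], 0 <= K /\ ((s <= D)%N ->
    forall (l k' : nat) (A F : {poly R[i]}), (0 < l)%N -> (k' <= 14)%N ->
      A`_0 = 1 -> (forall j, (j <= D)%N -> `|A`_j| <= 1 + C%:C) ->
      (forall m, (m <= D)%N ->
        \sum_(r < m.+1) F`_(D - r) * ((G ^+ 3 * V) ^+ (D - r))`_(m - r) =
        (V ^+ l * (A * W k'))`_m) ->
      l%:R * `|F`_(D - s) - (24%:R * l%:R) ^+ s / s`!%:R| <= K * l%:R ^+ s).
  have [sD|] := leqP s D; last by exists 0.
  have [K K0 HK] := faber_coef_asymp 14 C0 V0 J0 W0 sD.
  by exists K; split => // _; rewrite -V1.
pose Kc s := 26%:R * s`!%:R * Ks s + (28 * s)%:R.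
have Kc0 s : 0 <= Kc s by rewrite addr_ge0// !mulr_ge0//; case: (HKs s).
(* One constant for all s <= D. The [Kc s] are nonnegative complex numbers, hence the real parts;
   the 1 ensures positivity. *)
exists (1 + \sum_(s < D.+1) complex.Re (Kc s)).
  rewrite ltr_pwDl// sumr_ge0// => s _.
  by rewrite -lecR (RRe_real (ger0_real (Kc0 s))).
move=> k l k' f a F _ kE k'E Dl _ fA aC fF s sD.
have Dl' : (D <= l)%N by rewrite (leq_trans _ Dl)// addn1.
have l0 : (0 < l)%N by rewrite (leq_trans _ Dl')// (leq_trans _ hD).
have k14 : (k' <= 14)%N.
  by move: k'E; rewrite !inE => /or4P[|||/or3P[||]] /eqP ->.
pose A : {poly R[i]} := 1 + \sum_(1 <= j < D.+1) a j *: 'X^j.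
have AE j : A`_j = if j == 0%N then 1 else if (j <= D)%N then a j else 0.
  rewrite /A coefD coef1 coef_sum; case: eqVneq => [->|j0].
    rewrite big1_seq ?addr0// => i.
    rewrite mem_index_iota => /andP[_ /andP[i0 _]].
    by rewrite coefZ coefXn ltn_eqF// mulr0.
  under eq_bigr do rewrite coefZ coefXn mulr_natr mulrb eq_sym.
  by rewrite -big_mkcond big_nat1_eq lt0n j0 ltnS add0r.
(* Here [M] depends on [F], so fresh expansions to order M + 1 are taken. Only the degree bound is
   kept, so no constant inherits this dependence. *)
have sF : (size F <= D.+1)%N.
  pose M := maxn D (size F); have DM : (D <= M)%N by exact: leq_maxl.
  have sM : (size F <= M.+1)%N by rewrite leqW// leq_maxr.
  have [V' [V'0 _ aV']] := @inv_euler_pow_qapprox R 24 M.+1 (leq_trans hD DM).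
  have [G' G'0 aG'] := @eisenstein_qapprox R 4 M.+1 isT.
  have [W' [W'0 aW']] := @inv_eisenstein_qapprox R k' M.+1 isT.
  exact: (size_faber_poly DM Dl' V'0 G'0 W'0 aV' aG' aW' fA fF sM).
have sys m : (m <= D)%N ->
    \sum_(r < m.+1) F`_(D - r) * ((G ^+ 3 * V) ^+ (D - r))`_(m - r) =
    (V ^+ l * (A * W k'))`_m.
  move=> mD; have [_ aW] := HW k'.
  rewrite (faber_coef_system (leqnn D) Dl' V0 (W0 k') aV aG aW fA fF sF mD).
  by rewrite subnn expr0 mul1r.
have A_le j : (j <= D)%N -> `|A`_j| <= 1 + C%:C.
  move=> jD; rewrite AE jD; case: eqVneq => [_|j0].
    by rewrite normr1 lerDl ler0c ltW.
  by rewrite (le_trans (aC j _)) ?lt0n ?j0// lerDr.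
have A0 : A`_0 = 1 by rewrite AE.
have [Ks0 HK] := HKs s.
have H := weight_asymp Ks0 l0 k14 kE (HK sD l k' A F l0 k14 A0 A_le sys).
(* The coefficient in question is F_(D-s) (2k)^(D-s) / (2k)^D = F_(D-s) / (2k)^s, which dictates
   this relative error. *)
exists (s`!%:R * F`_(D - s) / (2 * k)%:R ^+ s - 1).
  apply: le_trans H _; rewrite -/(Kc s) rmorphM fmorphV rmorph_nat ler_wpM2r//.
  rewrite -(RRe_real (ger0_real (Kc0 s))) lecR.
  rewrite (bigD1 (Ordinal (sD : (s < D.+1)%N)))//= addrCA lerDl addr_ge0//.
  rewrite sumr_ge0// => i _.
  by rewrite -lecR (RRe_real (ger0_real (Kc0 i))).
have k0 : (2 * k)%:R != 0 :> R[i] by rewrite pnatr_eq0; lia.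
have f0 : s`!%:R != 0 :> R[i] by rewrite pnatr_eq0 -lt0n fact_gt0.
rewrite coefZ coef_comp_scaleX addrC subrK.
rewrite -{1}(subnK sD) exprD.
move: (expf_neq0 (D - s) k0) (expf_neq0 s k0).
move: (_ ^+ (D - s)) (_ ^+ s) (s`!%:R) f0 (F`_(D - s)) => x y z z0 u x0 y0.
by field; rewrite x0 y0 z0.
Qed.
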